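(* Let $(X,d)$ be a compact metric space and let $(G,(X_v)_{v\in V},(f_e)_{e\in E})$ be a contractive graph-directed IFS on $X$ with attractor $(A_v)_{v\in V}$. Then this attractor is obtained from a contractive local IFS on a compact subset of an enriched compact metric space, in the following sense: the space $Y=X\times V$ with the metric $d_Y((x,v),(y,w))=d(x,y)+\mathbf 1_{\{v\ne w\}}$ is a compact metric space which is an enriched version of $X$, and there exists a contractive local IFS on a compact subset of $Y$ whose local attractor $B$ satisfies $A_v=\pi_1\big(B\cap(X\times\{v\})\big)$ for every $v\in V$, where $\pi_1:Y\to X$ is the projection on the first coordinate.
   Context: Graph-directed IFS: $G=(V,E,i,t)$ is a finite directed graph with vertex set $V$ and edge set $E\subset V^2$; for an edge $e=(u,v)$ put $i(e)=u$ (initial vertex) and $t(e)=v$ (final vertex). A (contractive) graph-directed IFS $(G,(X_v)_{v\in V},(f_e)_{e\in E})$ on $X$ consists of such a graph, a family $(X_v)_{v\in V}$ of compact subsets of $X$, and contractions $f_e:X_{t(e)}\to X_{i(e)}$, $e\in E$ (each Lipschitz with a constant in $[0,1)$). Let $\mathcal K$ be the set of families $(B_v)_{v\in V}$ with each $B_v$ a non-empty compact subset of $X_v$. The fractal operator is $(F_G((B_v)_{v\in V}))_u=\bigcup_{e\in E,\,i(e)=u}f_e(B_{t(e)})$, $u\in V$. The attractor is the unique $(A_v)_{v\in V}\in\mathcal K$ fixed by $F_G$, i.e. $A_v=\bigcup_{e\in E,\,i(e)=v}f_e(A_{t(e)})$ for all $v\in V$. A metric space $Y$ is an enriched version of a metric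 space $X$ if there is an isometric embedding $X\to Y$. $\mathbf 1_{\{v\neq w\}}$ equals $1$ if $v\ne w$ and $0$ otherwise. A contractive local IFS on a compact metric space $Z$ is a family $(D_j,g_j)_{1\le j\le m}$, $m\ge2$, where each $D_j\subseteq Z$ is closed and each $g_j:D_j\to Z$ is a contraction (Lipschitz constant in $[0,1)$). Its local attractor is the largest (for inclusion) set $B\subseteq Z$ with $B=\bigcup_{j}g_j(B\cap D_j)$, when this set is non-empty. *)

(* Defs.v *)
(* MathComp-Analysis *)
From HB Require Import structures.
From mathcomp Require Import all_boot all_order all_algebra.
From mathcomp Require Import all_classical all_reals all_analysis.
Set Implicit Arguments.
Unset Strict Implicit.
Unset Printing Implicit Defensive.
Import Order.TTheory GRing.Theory Num.Theory.
Local Open Scope classical_set_scope.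
Local Open Scope ring_scope.

Record is_metric (R : realType) (T : choiceType) (d : T -> T -> R) : Prop :=
  IsMetric {
    is_metric_xx : forall x, d x x = 0 ;
    is_metric_eq : forall x y, d x y = 0 -> x = y ;
    is_metric_sym : forall x y, d x y = d y x ;
    is_metric_triangle : forall y x z, d x z <= d x y + d y z
  }.

(* The carrier T, equipped with the distance d and the topology induced by d;
   on it [mdist] is convertible to d. For T a product this is a different
   structure from the library's product topology, hence the alias. *)
Definition metric_of (R : realType) (T : choiceType) (d : T -> T -> R)
  (dM : is_metric d) : Type := T.

Section metric_of_instance.
Variables (R : realType) (T : choiceType) (d : T -> T -> R) (dM : is_metric d).

HB.instance Definition _ := Choice.on (metric_of dM).
HB.instance Definition _ := @isMetric.Build R (metric_of dM) d
  (is_metric_xx dM) (is_metric_eq dM) (is_metric_sym dM)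
  (is_metric_triangle dM).

End metric_of_instance.

Definition contraction_on (R : realType) (X Y : metricType R) (A : set X)
    (f : X -> Y) : Prop :=
  exists2 k : R, 0 <= k < 1 &
    forall x y, A x -> A y -> mdist (f x) (f y) <= k * mdist x y.

Definition enriched_version (R : realType) (X Y : metricType R) : Prop :=
  exists h : X -> Y, forall x y, mdist (h x) (h y) = mdist x y.

Section graph_directed_ifs.
Variables (R : realType) (X : metricType R) (V : finType).
(* An edge e is the pair (i(e), t(e)) = (e.1, e.2). The maps f e are total
   functions of which only the values on Xv e.2, for e \in E, are meaningful. *)
Variables (E : {set V * V}) (Xv : V -> set X) (f : V * V -> X -> X).

Definition gd_ifs : Prop :=
  (forall v, compact (Xv v)) /\
  (forall e, e \in E ->
     set_fun (Xv e.2) (Xv e.1) (f e) /\ contraction_on (Xv e.2) (f e)).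

Definition gd_compacts : set (V -> set X) :=
  [set B | forall v, [/\ B v !=set0, compact (B v) & B v `<=` Xv v]].

Definition gd_fractal_op (B : V -> set X) : V -> set X :=
  fun u => \bigcup_(e in [set e | e \in E /\ e.1 = u]) (f e @` B e.2).

Definition gd_attractor (A : V -> set X) : Prop :=
  [/\ gd_compacts A, gd_fractal_op A = A &
      forall B, gd_compacts B -> gd_fractal_op B = B -> B = A].

End graph_directed_ifs.

Section local_ifs.
Variables (R : realType) (Y : metricType R) (Z : set Y).
(* The ambient space is the subset Z of Y with the restricted metric; g j is a
   total function of which only the values on D j are meaningful. *)
Variables (m : nat) (D : 'I_m -> set Y) (g : 'I_m -> Y -> Y).

Definition local_ifs : Prop :=
  (2 <= m)%N /\
  forall j, [/\ D j `<=` Z, closed (D j : set (subspace Z)),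
                set_fun (D j) Z (g j) & contraction_on (D j) (g j)].

Definition local_invariant (B : set Y) : Prop :=
  B `<=` Z /\ B = \bigcup_(j in [set: 'I_m]) (g j @` (B `&` D j)).

Definition local_attractor (B : set Y) : Prop :=
  [/\ local_invariant B, forall C, local_invariant C -> C `<=` B & B !=set0].

End local_ifs.

Definition vertex_dist (R : realType) (X : metricType R) (V : finType)
    (p q : X * V) : R :=
  mdist p.1 q.1 + (p.2 != q.2)%:R.

(* Main.v *)
Require Import Defs.
From HB Require Import structures.
From mathcomp Require Import all_boot all_order all_algebra.
From mathcomp Require Import all_classical all_reals all_analysis.
Set Implicit Arguments.
Unset Strict Implicit.
Unset Printing Implicit Defensive.
Import Order.TTheory GRing.Theory Num.Theory.
Import numFieldNormedType.Exports.
Local Open Scope classical_set_scope.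
Local Open Scope ring_scope.

(** A point of Y = X * V is a point of X tagged with a vertex, so a subset of Y
    is the same thing as a family of subsets of X indexed by V ([total_set]
    below). Each edge e = (u, w) is turned into the map (x, w) |-> (f e x, u)
    with domain Xv w * {w}. On such a domain the metric of Y is the metric of X,
    so this map is a contraction and its domain is compact. Under the
    correspondence between subsets of Y and families, the operator of this local
    IFS on Z = \bigcup_v Xv v * {v} becomes the fractal operator of the graph
    ([bigcup_edge_map]); hence the total set of the attractor is invariant.

    It remains to see that it is the largest invariant set. An invariant set
    need not be closed and may miss some vertices, so uniqueness of the
    attractor does not apply to it. Instead, by [subinvariant_sub_attractor],
    any family C contained in its own image lies in A: each point of C is the
    image of a point of C under one of the maps, and pulling back n times shows
    that it is within k ^+ n * M of A, where k < 1 is a common contraction ratio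
    and M bounds the distances in X; as A is closed, the point is in A.

    The maps are indexed by two copies of V * V, pairs that are not edges having
    an empty domain: a local IFS has at least two maps, while the graph may have
    a single edge. *)

(** * Metric preliminaries *)

Lemma isometry_continuous (R : realType) (X Y : metricType R) (h : X -> Y) :
  (forall x y, mdist (h x) (h y) = mdist x y) -> continuous h.
Proof.
move=> hd x; apply/cvg_ballP => e e0; near=> y.
rewrite ballEmdist /= hd.
have : ball x e y by near: y; exact: nbhsx_ballx.
by rewrite ballEmdist.
Unshelve. all: by end_near. Qed.

Lemma mdist_continuous (R : realType) (X : metricType R) (a : X) :
  continuous (mdist a : X -> R).
Proof.
move=> x; apply/cvgrPdist_lt => e e0; near=> y.
have : ball x e y by near: y; exact: nbhsx_ballx.
rewrite ballEmdist /=; apply: le_lt_trans.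
rewrite ler_norml lerBlDl lerNl opprB lerBlDl.
by rewrite {2}[mdist x y]metric_sym !metric_triangle.
Unshelve. all: by end_near. Qed.

Lemma compact_mdist_bounded (R : realType) (X : metricType R) :
  compact [set: X] -> exists M : R, forall x y : X, mdist x y <= M.
Proof.
move=> cX; have [[a _]|X0] := pselect ([set: X] !=set0); last first.
  by exists 0 => x; exfalso; apply: X0; exists x.
have [b _ bP] : exists2 b, b \in [set: X] &
    forall x, x \in [set: X] -> mdist a x <= mdist a b.
  apply: compact_EVT_max => //; first by exists a.
  by apply: continuous_subspaceT; exact: mdist_continuous.
exists (mdist a b + mdist a b) => x y.
apply: le_trans (metric_triangle x a y) _.
by rewrite [mdist x a]metric_sym lerD// bP// inE.
Qed.

Lemma closed_approx (R : realType) (X : metricType R) (A : set X) (x : X) :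
  closed A -> (forall e : R, 0 < e -> exists2 a, A a & mdist x a < e) -> A x.
Proof.
move=> cA xA; apply: cA => U /nbhs_ballP[e /= e0 eU].
have [a Aa xa] := xA _ e0.
by exists a; split=> //; apply: eU; rewrite ballEmdist.
Qed.

(** * Families of sets contained in their image under the fractal operator *)

Lemma gd_ifs_common_ratio (R : realType) (X : metricType R) (V : finType)
    (E : {set V * V}) (Xv : V -> set X) (f : V * V -> X -> X) :
  gd_ifs E Xv f ->
  exists2 k : R, 0 <= k < 1 & forall e, e \in E ->
    forall x y, Xv e.2 x -> Xv e.2 y -> mdist (f e x) (f e y) <= k * mdist x y.
Proof.
move=> [_ fP].
have /choice[K KP] : forall e : V * V, exists k : R, 0 <= k < 1 /\ (e \in E ->
    forall x y, Xv e.2 x -> Xv e.2 y -> mdist (f e x) (f e y) <= k * mdist x y).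
  move=> e; have [eE|neE] := boolP (e \in E); last by exists 0; rewrite lexx/=.
  by have [_ [k k01 kP]] := fP e eE; exists k.
exists (\big[Num.max/0]_e K e).
  rewrite bigmax_lt ?andbT ?bigmax_ge_id// => e _.
  by have [/andP[]] := KP e.
move=> e eE x y xX yX; have [_ /(_ eE x y xX yX)] := KP e.
move=> /le_trans; apply; rewrite ler_wpM2r ?mdist_ge0//.
exact: le_bigmax.
Qed.

(** No member of C is required to be closed or non-empty. *)
Lemma subinvariant_sub_attractor (R : realType) (X : metricType R)
    (V : finType) (E : {set V * V}) (Xv : V -> set X) (f : V * V -> X -> X)
    (A C : V -> set X) :
  compact [set: X] -> gd_ifs E Xv f -> gd_compacts Xv A ->
  gd_fractal_op E f A = A ->
  (forall v, C v `<=` Xv v) -> (forall v, C v `<=` gd_fractal_op E f C v) ->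
  forall v, C v `<=` A v.
Proof.
move=> cX XG AK FA CX CF v x Cx.
have [k /andP[k0 k1] kP] := gd_ifs_common_ratio XG.
have [M MP] := compact_mdist_bounded cX.
have approx n : forall u z, C u z -> exists2 a, A u a & mdist z a <= k ^+ n * M.
  elim: n => [|n IHn] u z Cz.
    by have [[a Aa] _ _] := AK u; exists a; rewrite // expr0 mul1r.
  have [e [eE eu] [y Cy <-]] := CF u z Cz.
  have [a Aa ya] := IHn _ _ Cy.
  exists (f e a); first by rewrite -FA; exists e => //; exists a.
  have [_ _ AX] := AK e.2.
  apply: (le_trans (kP e eE y a (CX _ _ Cy) (AX _ Aa))).
  by rewrite exprS -mulrA ler_wpM2l.
have [_ cA _] := AK v.
apply: closed_approx (compact_closed (@metric_hausdorff _ _) cA) _ => e e0.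
have : k ^+ n * M @[n --> \oo] --> (0 : R).
  by rewrite -(mul0r M); apply: cvgMr_tmp; apply: cvg_expr; rewrite ger0_norm.
move=> /cvgr_lt /(_ _ e0) [n _ /(_ n (leqnn n)) /= kne].
have [a Aa xa] := approx n v x Cx.
by exists a => //; exact: le_lt_trans kne.
Qed.

(** * The metric space X * V *)

Lemma vertex_dist_is_metric (R : realType) (X : metricType R) (V : finType) :
  is_metric (@vertex_dist R X V).
Proof.
split.
- by move=> x; rewrite /vertex_dist mdistxx eqxx addr0.
- move=> [x v] [y w]; rewrite /vertex_dist /= => /eqP.
  rewrite paddr_eq0 ?mdist_ge0// => /andP[/eqP/mdist_positivity -> ].
  by rewrite pnatr_eq0 eqb0 negbK => /eqP ->.
- by move=> x y; rewrite /vertex_dist metric_sym eq_sym.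
- move=> y x z; rewrite /vertex_dist addrACA lerD ?metric_triangle//.
  rewrite -natrD ler_nat.
  have [->|] := eqVneq x.2 y.2; first by rewrite add0n.
  by move=> _; rewrite (leq_trans (leq_b1 _))// leq_addr.
Qed.

(** The subset of X * V whose slice at the vertex v is B v. *)
Definition total_set (X V : Type) (B : V -> set X) : set (X * V) :=
  [set p | B p.2 p.1].

Lemma fst_total_set (X V : Type) (B : V -> set X) (v : V) :
  fst @` (total_set B `&` ([set: X] `*` [set v])) = B v.
Proof.
apply/seteqP; split => [_ [[x w] [/= Bx [_ /= wv]] <-]|x Bx].
  by rewrite -wv.
by exists (x, v).
Qed.

Section vertex_metric.
Variables (R : realType) (X : metricType R) (V : finType).
Variable dY : is_metric (@vertex_dist R X V).
Let Y : metricType R := metric_of dY.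

Lemma vertex_inj_isometry (v : V) (x y : X) :
  mdist ((x, v) : Y) ((y, v) : Y) = mdist x y.
Proof. by rewrite /mdist /= /vertex_dist /= eqxx addr0. Qed.

Lemma compact_slice (K : set X) (v : V) :
  compact K -> compact ([set p | p.2 = v /\ K p.1] : set Y).
Proof.
move=> cK; rewrite (_ : mkset _ = (fun x => (x, v) : Y) @` K).
  apply: continuous_compact cK; apply: continuous_subspaceT.
  exact/isometry_continuous/vertex_inj_isometry.
apply/seteqP; split => [[x w] /= [-> Kx]|_ [x Kx <-]//].
by exists x.
Qed.

Lemma compact_total_set (B : V -> set X) :
  (forall v, compact (B v)) -> compact (total_set B : set Y).
Proof.
move=> cB; rewrite (_ : total_set B =
    \big[setU/set0]_(v <- enum V) ([set p | p.2 = v /\ B v p.1] : set Y)).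
  by apply: bigsetU_compact => v _; exact: compact_slice.
rewrite -bigcup_seq; apply/seteqP; split => [p Bp|p [v _ [/= <-]]//].
by exists p.2 => //=; rewrite mem_enum.
Qed.

End vertex_metric.

(** * The local IFS of a graph-directed IFS *)

(** The domain of the map of the edge e; it is empty when e is not an edge of
    the graph, which allows all the pairs of vertices to be used as indices. *)
Definition edge_dom (X : Type) (V : finType) (E : {set V * V})
    (Xv : V -> set X) (e : V * V) : set (X * V) :=
  [set p | e \in E /\ p.2 = e.2 /\ Xv e.2 p.1].

(** The map of the edge e: it applies f e to the point and moves the tag to the
    initial vertex of e. *)
Definition edge_map (X V : Type) (f : V * V -> X -> X) (e : V * V)
    (p : X * V) : X * V := (f e p.1, e.1).

(** The Hutchinson operator of the maps of the edges is the fractal operator of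
    the graph, read on total sets. *)
Lemma bigcup_edge_map (R : realType) (X : metricType R) (V : finType)
    (E : {set V * V}) (Xv : V -> set X) (f : V * V -> X -> X)
    (B : V -> set X) :
  (forall v, B v `<=` Xv v) ->
  \bigcup_(e in [set: V * V])
    (edge_map f e @` (total_set B `&` edge_dom E Xv e)) =
  total_set (gd_fractal_op E f B).
Proof.
move=> BX; apply/seteqP; split => [_ [e _ [[x w] [/= Bx [eE [/= we _]]]] <-]|].
  by exists e => //; exists x => //; rewrite -we.
move=> [_ _] [e /= [eE <-] [x Bx <-]].
exists e => //; exists (x, e.2) => //; split => //.
by do 2!split => //; exact: BX.
Qed.

Section local_ifs_of_graph.
Variables (R : realType) (X : metricType R) (V : finType).
Variables (E : {set V * V}) (Xv : V -> set X) (f : V * V -> X -> X).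
Variable dY : is_metric (@vertex_dist R X V).
Let Y : metricType R := metric_of dY.

(** Each pair of vertices occurs twice among the indices. *)
Let m := #|{: bool * (V * V)}|.
Let D (j : 'I_m) : set Y := edge_dom E Xv (enum_val j).2.
Let g (j : 'I_m) : Y -> Y := edge_map f (enum_val j).2.

Lemma local_ifs_edge_map : (0 < #|V|)%N -> gd_ifs E Xv f ->
  local_ifs (total_set Xv : set Y) D g.
Proof.
move=> V0 [cX fP]; split.
  by rewrite /m !card_prod card_bool -[X in (X <= _)%N]muln1 leq_mul// muln_gt0 V0.
move=> j; rewrite /D /g; set e := (enum_val j).2.
split.
- by move=> p [_ [pe]]; rewrite /total_set /= pe.
- apply: closed_subspaceW; have [eE|neE] := boolP (e \in E); last first.
    rewrite (_ : edge_dom _ _ _ = set0); first exact: closed0.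
    by apply/seteqP; split => p []; rewrite (negbTE neE).
  rewrite (_ : edge_dom E Xv e = [set p | p.2 = e.2 /\ Xv e.2 p.1]).
    exact/(compact_closed (@metric_hausdorff _ _))/compact_slice.
  by apply/seteqP; split => [p []|].
- by move=> p [eE [_ Xp]]; have [fX _] := fP e eE; exact: fX.
- have [eE|neE] := boolP (e \in E); last first.
    by exists 0 => [|p q []]; rewrite ?lexx ?ltr01 ?(negbTE neE).
  have [_ [k k01 kP]] := fP e eE; exists k => //.
  move=> [x v] [y w] [_ [/= -> Xx]] [_ [/= -> Xy]].
  rewrite !vertex_inj_isometry; exact: kP.
Qed.

Lemma local_invariant_total_set (B : V -> set X) :
  local_invariant (total_set Xv : set Y) D g (total_set B : set Y) <->
  (forall v, B v `<=` Xv v) /\ gd_fractal_op E f B = B.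
Proof.
have bigcupE : (forall v, B v `<=` Xv v) ->
    \bigcup_(j in [set: 'I_m]) (g j @` ((total_set B : set Y) `&` D j)) =
    total_set (gd_fractal_op E f B).
  move=> BX; rewrite -(bigcup_edge_map E f BX).
  apply/seteqP; split => p [] => [j _|e _] gp.
    by exists (enum_val j).2.
  by exists (enum_rank (true, e)) => //; rewrite /g /D enum_rankK.
split=> [[BX BE]|[BX BF]].
  have BX' v : B v `<=` Xv v by move=> x /(BX (x, v)).
  split=> //; move: BE; rewrite bigcupE// => BE.
  apply/funext => v; apply/seteqP; split => x.
    by move=> Fx; have : total_set B (x, v) by rewrite BE.
  by move=> Bx; have : total_set B (x, v) by []; rewrite BE.
by split; [move=> p; exact: BX | rewrite bigcupE// BF].
Qed.

Lemma local_attractor_total_set (A : V -> set X) :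
  compact [set: X] -> (0 < #|V|)%N -> gd_ifs E Xv f -> gd_attractor E Xv f A ->
  local_attractor (total_set Xv : set Y) D g (total_set A : set Y).
Proof.
move=> cX /card_gt0P[v0 _] XG [AK FA _]; split.
- by apply/local_invariant_total_set; split => // v; have [] := AK v.
- move=> C; rewrite (_ : C = total_set (fun v => [set x | C (x, v)])); last first.
    by apply/seteqP; split => -[].
  move=> /local_invariant_total_set[CX FC] p.
  have CF v : [set x | C (x, v)] `<=`
      gd_fractal_op E f (fun u => [set x | C (x, u)]) v by rewrite FC.
  exact: (subinvariant_sub_attractor cX XG AK FA CX CF).
- by have [[x Ax] _ _] := AK v0; exists (x, v0).
Qed.

End local_ifs_of_graph.

Theorem theorem7 (R : realType) (X : metricType R) (V : finType)
    (E : {set V * V}) (Xv : V -> set X) (f : V * V -> X -> X)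
    (A : V -> set X)
    (X_compact : compact [set: X])
    (V_nonempty : (0 < #|V|)%N)
    (X_gd_ifs : gd_ifs E Xv f)
    (A_attractor : gd_attractor E Xv f A) :
  exists dY_metric : is_metric (@vertex_dist R X V),
    let Y : metricType R := metric_of dY_metric in
    [/\ compact [set: Y],
        enriched_version X Y &
        exists (Z : set Y) (m : nat) (D : 'I_m -> set Y) (g : 'I_m -> Y -> Y)
               (B : set Y),
          [/\ compact Z,
              local_ifs Z D g,
              local_attractor Z D g B &
              forall v : V,
                A v = fst @` ((B : set (X * V)) `&` ([set: X] `*` [set v]))]].
Proof.
have dY := @vertex_dist_is_metric R X V; exists dY => Y.
have [v0 _] := card_gt0P V_nonempty.
split.
- exact: (@compact_total_set _ _ _ dY (fun=> setT) (fun=> X_compact)).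
- by exists (fun x => (x, v0) : Y) => x y; exact: vertex_inj_isometry.
- exists (total_set Xv), #|{: bool * (V * V)}|.
  exists (fun j => edge_dom E Xv (enum_val j).2).
  exists (fun j => edge_map f (enum_val j).2), (total_set A); split.
  + by apply: compact_total_set; have [] := X_gd_ifs.
  + exact: local_ifs_edge_map.
  + exact: local_attractor_total_set.
  + by move=> v; rewrite fst_total_set.
Qed.
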